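(* Let $q$ be a real number with $q\neq 0,\pm1$, let $m$ be a positive integer and let $n=2m-1$. The $n$-th symmetric Gaussian Riemann difference ${_q}\Delta_n^s(x,h;f)$ is the $n$-th generalized Riemann difference based at $x\pm h,x\pm qh,x\pm q^2h,\ldots ,x\pm q^{m-1}h$, and it has the expression ${_q}\Delta_n^s(x,h;f)=\lambda_n^s\cdot {_q}\widetilde{\Delta}_n^s(x,h;f)$, where $${_q}\widetilde{\Delta}_n^s(x,h;f)=\sum_{k=0}^{m-1}(-1)^kq^{k^2}\left[\begin{array}{c}m-1\\k\end{array}\right]_{q^2}\left\{f(x+q^{m-1-k}h)-f(x-q^{m-1-k}h)\right\}$$ and $\lambda_n^s=n!/\left(2(q^n-q)(q^n-q^3)\cdots (q^n-q^{n-2})\right)$.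
   Context: An $n$-th generalized Riemann difference is $\Delta_{\mathcal{A}}(x,h;f)=\sum_{k=0}^{\ell}A_kf(x+a_kh)$, where the real numbers $A_k$ are non-zero, the real numbers $a_k$ are distinct, and $\sum_{k=0}^{\ell}A_ka_k^j=\delta_{j,n}\cdot n!$ for $j=0,1,\ldots ,n$ (with $0^0=1$). The points $x+a_kh$ are its base points. When there are exactly $n+1$ base points, the $A_k$ are uniquely determined by the $a_k$. For odd $n$ with $m=\lfloor (n+1)/2\rfloor=(n+1)/2$, the $n$-th symmetric Gaussian Riemann difference is by definition the $n$-th generalized Riemann difference based at $x\pm h,x\pm qh,\ldots ,x\pm q^{m-1}h$. For real $p$: $[k]_p=1+p+\cdots +p^{k-1}$, $[k]_p!=[1]_p[2]_p\cdots [k]_p$ with $[0]_p!=1$, and $\left[\begin{array}{c}n\\k\end{array}\right]_p=\frac{[n]_p!}{[n-k]_p!\,[k]_p!}$ for $0\le k\le n$; here it is used with $p=q^2$. Empty products equal $1$. *)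

(* Defs.v *)
From mathcomp Require Import all_boot all_order all_algebra.
From mathcomp Require Import reals.

Set Implicit Arguments.
Unset Strict Implicit.
Unset Printing Implicit Defensive.

Import Order.TTheory GRing.Theory Num.Theory.
Local Open Scope ring_scope.

(* In [grd_moments], [0 ^+ 0 = 1], as in the convention [0^0 = 1]. *)
Record gen_riemann_diff (R : realType) (n : nat) := GenRiemannDiff {
  grd_len : nat;
  grd_coef : 'I_grd_len.+1 -> R;
  grd_node : 'I_grd_len.+1 -> R;
  grd_coef_neq0 : forall k, grd_coef k != 0;
  grd_node_inj : injective grd_node;
  grd_moments : forall j : nat, (j <= n)%N ->
    \sum_(k < grd_len.+1) grd_coef k * grd_node k ^+ j
      = if j == n then n`!%:R else 0
}.

Arguments grd_len {R n} g.
Arguments grd_coef {R n} g k.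
Arguments grd_node {R n} g k.

Definition grd_eval (R : realType) (n : nat) (D : gen_riemann_diff R n)
    (x h : R) (f : R -> R) : R :=
  \sum_(k < (grd_len D).+1) grd_coef D k * f (x + grd_node D k * h).

(* The base points of [D] are the points [x + a * h] with [a \in s]. *)
Definition grd_based_at (R : realType) (n : nat) (D : gen_riemann_diff R n)
    (s : seq R) : Prop :=
  codom (grd_node D) =i s.

Definition sym_gauss_nodes (R : realType) (q : R) (m : nat) : seq R :=
  [seq q ^+ i | i <- iota 0 m] ++ [seq - q ^+ i | i <- iota 0 m].

(* [D] is the [n]-th symmetric Gaussian Riemann difference, for [n] odd and
   [m = (n + 1) / 2]; for [q] other than 0, 1, -1 the list has [n + 1] distinct
   entries, so that [D] is determined up to the order of its terms. *)
Definition is_sym_gauss_diff (R : realType) (q : R) (n : nat)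
    (D : gen_riemann_diff R n) : Prop :=
  grd_based_at D (sym_gauss_nodes q n.+1./2).

Definition qint (R : realType) (p : R) (k : nat) : R := \sum_(i < k) p ^+ i.

Definition qfact (R : realType) (p : R) (k : nat) : R :=
  \prod_(1 <= i < k.+1) qint p i.

(* Meaningful for [k <= n] only. *)
Definition qbinom (R : realType) (p : R) (n k : nat) : R :=
  qfact p n / (qfact p (n - k) * qfact p k).

Definition sym_gauss_tilde (R : realType) (q : R) (m : nat)
    (x h : R) (f : R -> R) : R :=
  \sum_(k < m) (-1) ^+ k * q ^+ (k ^ 2)%N * qbinom (q ^+ 2) (m - 1)%N k *
    (f (x + q ^+ (m - 1 - k)%N * h) - f (x - q ^+ (m - 1 - k)%N * h)).

(* The product has the factors [q^n - q^j] for [j = 1, 3, ..., n - 2]. *)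
Definition sym_gauss_lambda (R : realType) (q : R) (n : nat) : R :=
  n`!%:R / (2 * \prod_(1 <= j < n | odd j) (q ^+ n - q ^+ j)).

(* Main.v *)
Require Import Defs.
From mathcomp Require Import all_boot all_order all_algebra.
From mathcomp Require Import reals.
From mathcomp Require Import ring.

Set Implicit Arguments.
Unset Strict Implicit.
Unset Printing Implicit Defensive.

Import Order.TTheory GRing.Theory Num.Theory.
Local Open Scope ring_scope.

(* When there are at most [n + 1] base points, replacing [f] by its
   interpolation polynomial [P] at those points shows that the moment
   conditions force the value of the difference to be [n!] times the
   coefficient of degree [n] of [P]; hence it suffices to exhibit one
   difference of the announced form.  Its even moments vanish by antisymmetry.
   With [p = q ^ 2] and [N = m - 1], its moment of order [2 * i + 1] is, up to
   the factor [2 * lambda * q ^ N], the value at [y = p ^ i] of the Gauss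
   binomial expansion of [(y - 1) (y - p) ... (y - p ^ (N - 1))]: it vanishes
   for [i < N], and [lambda] normalizes it for [i = N]. *)

(** * Interpolation, and uniqueness of a difference with given base points *)

Lemma interpolation_exists (F : fieldType) (s : seq F) (g : F -> F) :
  exists2 P : {poly F}, (size P <= size s)%N & {in s, forall a, P.[a] = g a}.
Proof.
elim: s => [|b s [P sP gP]]; first by exists 0; rewrite ?size_poly0.
have [bs|bNs] := boolP (b \in s).
  exists P; first exact: leq_trans sP (leqnSn _).
  by move=> a; rewrite inE => /predU1P[->|]; apply: gP.
pose W := \prod_(a <- s) ('X - a%:P).
have Wb : W.[b] != 0 by rewrite -[_ == 0]/(root W b) root_prod_XsubC.
(* Newton's correction: [W] vanishes on [s], so the values there are kept, and its factor is chosen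
   to produce [g b] at [b]. *)
exists (P + ((g b - P.[b]) / W.[b]) *: W).
  rewrite (leq_trans (size_polyD _ _)) // geq_max (leq_trans sP) //=.
  by rewrite (leq_trans (size_scale_leq _ _)) // size_prod_XsubC.
move=> a; rewrite inE hornerD hornerZ => /predU1P[->|as_].
  by rewrite divfK // addrC subrK.
have /eqP -> : W.[a] == 0 by rewrite -[_ == 0]/(root W a) root_prod_XsubC.
by rewrite mulr0 addr0 gP.
Qed.

Section Uniqueness.
Variables (R : realType) (n : nat).

Lemma grd_polyE (D : gen_riemann_diff R n) (P : {poly R}) : (size P <= n.+1)%N ->
  \sum_k grd_coef D k * P.[grd_node D k] = P`_n * n`!%:R.
Proof.
move=> sP.
under eq_bigr => k _ do rewrite (horner_coef_wide _ sP) mulr_sumr.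
rewrite exchange_big /= big_ord_recr /= big1 ?add0r => [|i _].
  under eq_bigr => k _ do rewrite mulrCA.
  by rewrite -mulr_sumr grd_moments // eqxx.
under eq_bigr => k _ do rewrite mulrCA.
rewrite -mulr_sumr grd_moments; last exact: ltnW.
by rewrite (ltn_eqF (ltn_ord i)) mulr0.
Qed.

Lemma grd_eval_unique (D D' : gen_riemann_diff R n) (s : seq R) (x h : R)
    (f : R -> R) : (size s <= n.+1)%N -> grd_based_at D s ->
  grd_based_at D' s -> grd_eval D x h f = grd_eval D' x h f.
Proof.
move=> ss.
have [P sP gP] := interpolation_exists s (fun a => f (x + a * h)).
suff evalP (E : gen_riemann_diff R n) :
    grd_based_at E s -> grd_eval E x h f = P`_n * n`!%:R.
  by move=> sD sD'; rewrite !evalP.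
move=> sE; rewrite -(grd_polyE E (leq_trans sP ss)).
by apply: eq_bigr => k _; rewrite gP // -sE codom_f.
Qed.

End Uniqueness.

(** * Gaussian binomial coefficients *)

Lemma sqrn_bin2 k : (k ^ 2 = 2 * 'C(k, 2) + k)%N.
Proof.
elim: k => // k IHk.
by rewrite binS bin1 -addn1 sqrnD IHk exp1n muln1; ring.
Qed.

Section GaussBinomial.
Variables (R : realType) (p : R).

Lemma qintD a b : qint p (a + b) = qint p a + p ^+ a * qint p b.
Proof.
rewrite /qint big_split_ord /= mulr_sumr; congr (_ + _).
by apply: eq_bigr => i _; rewrite exprD.
Qed.

Lemma qfact0 : qfact p 0 = 1.
Proof. by rewrite /qfact big_geq. Qed.

Lemma qfactS k : qfact p k.+1 = qfact p k * qint p k.+1.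
Proof. by rewrite /qfact big_nat_recr. Qed.

Hypothesis p_ge0 : 0 <= p.

(** The term of index 0 is 1 and, as [p] is nonnegative, no other term is negative. This will be
    applied to [p = q ^ 2]. *)
Lemma qint_neq0 k : qint p k.+1 != 0.
Proof.
rewrite /qint big_ord_recl /= expr0 gt_eqF // ltr_pwDl ?ltr01 //.
by apply: sumr_ge0 => i _; apply: exprn_ge0.
Qed.

Lemma qfact_neq0 k : qfact p k != 0.
Proof.
elim: k => [|k IHk]; first by rewrite qfact0 oner_neq0.
by rewrite qfactS mulf_neq0 ?qint_neq0.
Qed.

Lemma qbinom_neq0 N k : qbinom p N k != 0.
Proof. by rewrite /qbinom mulf_neq0 ?invr_eq0 ?mulf_neq0 ?qfact_neq0. Qed.

Lemma qbinom0 N : qbinom p N 0 = 1.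
Proof. by rewrite /qbinom subn0 qfact0 mulr1 divff ?qfact_neq0. Qed.

Lemma qbinomn N : qbinom p N N = 1.
Proof. by rewrite /qbinom subnn qfact0 mul1r divff ?qfact_neq0. Qed.

(** With [N = d + k + 1], clearing the factorials leaves [qint p (d + k + 2) = qint p (d + 1) + p ^
    (d + 1) * qint p (k + 1)]. The bound on [k] keeps [qbinom p N k.+1] in its meaningful range. *)
Lemma qbinomS N k : (k < N)%N ->
  qbinom p N.+1 k.+1 = qbinom p N k.+1 + p ^+ (N - k) * qbinom p N k.
Proof.
move=> /subnK <-; set d := (N - k.+1)%N.
rewrite /qbinom subSS !addnK addnS -addSn addnK.
have qN : qint p (d.+1 + k).+1 = qint p d.+1 + p ^+ d.+1 * qint p k.+1.
  by rewrite -addnS qintD.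
rewrite [qfact p (d.+1 + k).+1]qfactS qN !qfactS.
by field; rewrite !qint_neq0 !qfact_neq0.
Qed.

Lemma gauss_binomial N (y : R) :
  \sum_(k < N.+1) (-1) ^+ k * p ^+ 'C(k, 2) * qbinom p N k * y ^+ (N - k)
  = \prod_(j < N) (y - p ^+ j).
Proof.
elim: N => [|N IHN].
  by rewrite big_ord0 big_ord1 qbinom0 bin0n !expr0 !mulr1.
pose c M k := (-1) ^+ k * p ^+ 'C(k, 2) * qbinom p M k.
(* This compares the coefficients of [y ^ (N - k)] when the expansion for [N] is multiplied by
   [y - p ^ N]. *)
have cS k : (k < N)%N -> c N.+1 k.+1 = c N k.+1 - p ^+ N * c N k.
  move=> kN; rewrite /c qbinomS // exprS binS bin1 exprD.
  have -> : p ^+ N = p ^+ (N - k) * p ^+ k by rewrite -exprD subnK // ltnW.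
  by ring.
have cn : c N.+1 N.+1 = - (p ^+ N * c N N).
  by rewrite /c !qbinomn exprS binS bin1 exprD; ring.
have c0 M : c M 0%N = 1 by rewrite /c qbinom0 bin0n !mulr1.
rewrite [LHS]big_ord_recl [RHS]big_ord_recr -IHN /= mulrBr !mulr_suml -/(c _ _).
rewrite [X in _ = X - _]big_ord_recl [X in _ = _ - X]big_ord_recr big_ord_recr.
rewrite /= -!/(c _ _) !c0 cn !subn0 !subnn exprSr.
(* The terms in [y ^ (N + 1)] and [y ^ 0] have been split off on both sides; the remaining sums are
   matched term by term through [cS]. *)
set S0 := \big[_/_]_(_ < _) _; set S1 := \big[_/_]_(_ < _) _.
set S2 := \big[_/_]_(_ < _) _.
suff -> : S0 = S1 - S2 by ring.
rewrite -sumrB; apply: eq_bigr => k _; rewrite -!/(c _ _).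
rewrite [bump 0 k]add1n cS // subSS.
have -> : (N - k = (N - k.+1).+1)%N by rewrite subnSK.
by rewrite exprS; ring.
Qed.

End GaussBinomial.

(** * The explicit difference on the symmetric geometric nodes *)

Section SymmetricGaussian.
Variables (R : realType) (q : R).
Hypotheses (q_neq0 : q != 0) (q_neq1 : q != 1) (q_neqN1 : q != -1).

Lemma expr_norm_inj : injective (fun i => `|q| ^+ i).
Proof.
apply: ieexprIn; first by rewrite normr_gt0.
by apply: contraNneq q_neqN1 => /eqP; rewrite eqr_norml (negPf q_neq1) => /andP[].
Qed.

Lemma expr_inj : injective (fun i => q ^+ i).
Proof. by move=> i j /(congr1 Num.norm); rewrite !normrX => /expr_norm_inj. Qed.

(** Absolute values would force [i = j], and then [2 * q ^ j = 0]. *)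
Lemma expr_neqN i j : q ^+ i != - q ^+ j.
Proof.
apply/eqP => eq_ij; have /expr_norm_inj ij : `|q| ^+ i = `|q| ^+ j.
  by rewrite -!normrX eq_ij normrN.
move/eqP: eq_ij; rewrite ij -subr_eq0 opprK -mulr2n mulrn_eq0 /=.
by rewrite expf_eq0 (negPf q_neq0) andbF.
Qed.

Variable N : nat.

(** Each factor with exponent [2 * j + 1] is [q] times [p ^ N - p ^ j], where [p = q ^ 2]. *)
Lemma prod_oddE :
  \prod_(1 <= j < N.*2.+1 | odd j) (q ^+ N.*2.+1 - q ^+ j)
  = q ^+ N * \prod_(j < N) ((q ^+ 2) ^+ N - (q ^+ 2) ^+ j).
Proof.
have -> : q ^+ N = \prod_(j < N) q by rewrite prodr_const card_ord.
rewrite -big_split /=.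
have: forall M, \prod_(1 <= j < M.*2.+1 | odd j) (q ^+ N.*2.+1 - q ^+ j)
  = \prod_(j < M) (q ^+ N.*2.+1 - q ^+ j.*2.+1).
  elim=> [|M IHM]; first by rewrite big_geq ?big_ord0.
  rewrite doubleS big_mkcond big_nat_recr //= big_nat_recr //= -big_mkcond /=.
  by rewrite odd_double /= mulr1 big_ord_recr IHM.
move=> ->; apply: eq_bigr => j _; rewrite mulrBr -!exprM !mul2n.
by rewrite !exprS.
Qed.

Let n := N.*2.+1.

Lemma prod_odd_neq0 : \prod_(1 <= j < n | odd j) (q ^+ n - q ^+ j) != 0.
Proof.
rewrite prodf_seq_neq0; apply/allP => j; rewrite mem_index_iota => /andP[_ jn].
apply/implyP => _; rewrite subr_eq0; apply/eqP => /expr_inj nj.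
by rewrite nj ltnn in jn.
Qed.

Lemma sym_gauss_lambda_neq0 : sym_gauss_lambda q n != 0.
Proof.
rewrite mulf_neq0 ?invr_eq0 ?mulf_neq0 ?prod_odd_neq0 ?pnatr_eq0 //.
by rewrite -lt0n fact_gt0.
Qed.

Definition sg_coef (k : nat) : R :=
  sym_gauss_lambda q n * ((-1) ^+ k * q ^+ (k ^ 2)%N * qbinom (q ^+ 2) N k).

(** Coefficients and nodes are both antisymmetric, so one encoding serves for both. The index bound
    [N.+1 + N.+1] is convertible to [(N + N.+1).+1], the form required by the record with
    [grd_len = N + N.+1]. *)
Definition sg_signed (a : nat -> R) (k : 'I_(N.+1 + N.+1)) : R :=
  match split k with inl i => a i | inr i => - a i end.

Lemma sg_signedl a i : sg_signed a (lshift N.+1 i) = a i.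
Proof. by rewrite /sg_signed (unsplitK (inl i)). Qed.

Lemma sg_signedr a i : sg_signed a (rshift N.+1 i) = - a i.
Proof. by rewrite /sg_signed (unsplitK (inr i)). Qed.

Definition sg_node := sg_signed (fun k => q ^+ (N - k)).

Lemma sg_sumE (F : R -> R) :
  \sum_k sg_signed sg_coef k * F (sg_node k)
  = \sum_(k < N.+1) sg_coef k * (F (q ^+ (N - k)) - F (- q ^+ (N - k))).
Proof.
rewrite big_split_ord /= -big_split /=; apply: eq_bigr => k _.
by rewrite /sg_node !sg_signedl !sg_signedr mulrBr mulNr.
Qed.

Lemma sg_coef_neq0 k : sg_signed sg_coef k != 0.
Proof.
have c_neq0 i : sg_coef i != 0.
  rewrite /sg_coef mulf_neq0 ?sym_gauss_lambda_neq0 // -mulrA.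
  by rewrite mulf_neq0 ?signr_eq0 // mulf_neq0 ?expf_neq0 ?qbinom_neq0 ?sqr_ge0.
by rewrite /sg_signed; case: (split k) => i //; rewrite oppr_eq0.
Qed.

Lemma sg_node_inj : injective sg_node.
Proof.
move=> k l; rewrite -[k]splitK -[l]splitK /sg_node.
have eq_sub (i j : 'I_N.+1) : q ^+ (N - i) = q ^+ (N - j) -> i = j.
  move=> /expr_inj ij; apply: val_inj.
  by rewrite /= -(subKn (leq_ord i)) ij subKn ?leq_ord.
case: (split k) (split l) => i [] j /=; rewrite ?sg_signedl ?sg_signedr.
- by move=> /eq_sub ->.
- by move=> /eqP; rewrite (negPf (expr_neqN _ _)).
- by move=> /esym/eqP; rewrite (negPf (expr_neqN _ _)).
- by move=> /oppr_inj /eq_sub ->.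
Qed.

Lemma sg_moments j : (j <= n)%N ->
  \sum_k sg_signed sg_coef k * sg_node k ^+ j = if j == n then n`!%:R else 0.
Proof.
move=> jn; rewrite (sg_sumE (fun a => a ^+ j)).
have [oj|ej] := boolP (odd j); last first.
  rewrite (negPf (contraNneq _ ej)) => [|->]; last by rewrite /= odd_double.
  apply: big1 => k _; rewrite exprNn -signr_odd (negPf ej) mul1r.
  by rewrite subrr mulr0.
pose i := j./2; have jE : j = i.*2.+1 by rewrite -{1}(odd_double_half j) oj.
have iN : (i <= N)%N by rewrite -leq_double -ltnS -jE.
(* For odd [j] the two halves add up, whence the factor 2. Since [k ^ 2 = 2 * 'C(k, 2) + k], a
   factor [q ^ k] is left over; it joins the [q ^ (N - k)] coming from the node to form [q ^ N]. *)
transitivity (sym_gauss_lambda q n * 2 * q ^+ N *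
    \prod_(k < N) ((q ^+ 2) ^+ i - (q ^+ 2) ^+ k)).
  rewrite -gauss_binomial ?sqr_ge0 // mulr_sumr; apply: eq_bigr => k _.
  rewrite [(- _) ^+ j]exprNn -[(-1) ^+ j]signr_odd oj expr1 mulN1r opprK.
  rewrite -mulr2n /sg_coef.
  have -> : q ^+ (k ^ 2)%N = (q ^+ 2) ^+ 'C(k, 2) * q ^+ k.
    by rewrite -exprM -exprD -sqrn_bin2.
  have -> : (q ^+ (N - k)) ^+ j = ((q ^+ 2) ^+ i) ^+ (N - k) * q ^+ (N - k).
    by rewrite jE -!exprM -exprD -muln2; congr (_ ^+ _); ring.
  have -> : q ^+ N = q ^+ k * q ^+ (N - k) by rewrite -exprD subnKC ?leq_ord.
  by ring.
have [ij|jneq] := eqVneq j n.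
  have -> : i = N by apply: double_inj; apply: succn_inj; rewrite -jE.
  (* Twice [q ^ N] times the product is exactly the denominator of [sym_gauss_lambda]. *)
  rewrite -!mulrA -prod_oddE /sym_gauss_lambda -/n mulrA divfK //.
  by rewrite mulf_neq0 ?prod_odd_neq0 ?pnatr_eq0.
have ltiN : (i < N)%N.
  rewrite ltn_neqAle iN andbT; apply: contraNneq jneq => eqi.
  by rewrite jE eqi.
by rewrite (bigD1 (Ordinal ltiN)) //= subrr mul0r mulr0.
Qed.

Definition sg_diff : gen_riemann_diff R n :=
  @GenRiemannDiff R n (N + N.+1) (sg_signed sg_coef) sg_node
    sg_coef_neq0 sg_node_inj sg_moments.

Lemma sg_diff_based_at : grd_based_at sg_diff (sym_gauss_nodes q N.+1).
Proof.
move=> a; rewrite mem_cat; apply/codomP/orP => [[k ->]|].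
  rewrite -[grd_node _ _]/(sg_node k) /sg_node /sg_signed.
  case: (@split N.+1 N.+1 k) => i; [left|right];
    by apply/mapP; exists (N - i)%N; rewrite ?mem_iota ?add0n ?ltnS ?leq_subr.
case=> /mapP[i]; rewrite mem_iota add0n ltnS => /= iN ->.
  (* [sg_node] runs through the exponents in decreasing order, so exponent [i] sits at index
     [N - i]. *)
  exists (lshift N.+1 (inord (N - i))).
  by rewrite /sg_node sg_signedl inordK ?ltnS ?leq_subr // subKn.
exists (rshift N.+1 (inord (N - i))).
by rewrite /sg_node sg_signedr inordK ?ltnS ?leq_subr // subKn.
Qed.

Lemma sg_diff_eval x h f :
  grd_eval sg_diff x h f = sym_gauss_lambda q n * sym_gauss_tilde q N.+1 x h f.
Proof.
rewrite /grd_eval (sg_sumE (fun a => f (x + a * h))) mulr_sumr.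
by apply: eq_bigr => k _; rewrite mulNr /sg_coef subn1 -!mulrA.
Qed.

End SymmetricGaussian.

Theorem lemma1p4 (R : realType) (q : R) (m n : nat)
    (hq0 : q != 0) (hq1 : q != 1) (hqN1 : q != -1)
    (hm : (0 < m)%N) (hn : n = (2 * m - 1)%N) :
  (exists D : gen_riemann_diff R n, is_sym_gauss_diff q D) /\
  (forall D : gen_riemann_diff R n, is_sym_gauss_diff q D ->
     grd_based_at D (sym_gauss_nodes q m) /\
     forall (x h : R) (f : R -> R),
       grd_eval D x h f = sym_gauss_lambda q n * sym_gauss_tilde q m x h f).
Proof.
case: m hm hn => // N _; rewrite mul2n doubleS subn1 /= => ->.
have half_n : (N.*2.+2)./2 = N.+1 by rewrite -doubleS doubleK.
have size_nodes : size (sym_gauss_nodes q N.+1) = N.*2.+2.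
  by rewrite size_cat !size_map size_iota addnn doubleS.
have based := sg_diff_based_at hq0 hq1 hqN1 N.
rewrite /is_sym_gauss_diff half_n; split; first by exists (sg_diff hq0 hq1 hqN1 N).
move=> D sD; split=> // x h f.
(* The list has [2 * N + 2 = n + 1] entries, just within the bound for uniqueness, so [D] may be
   replaced by [sg_diff]. *)
rewrite (grd_eval_unique x h f _ sD based) ?size_nodes //.
exact: sg_diff_eval.
Qed.
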